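(* Let $X$ be an infinite-dimensional complex Banach space and $T\in L(X)$ be such that $\sigma_{ap}(T)=\partial\sigma(T)$ and no point of $\partial\sigma(T)$ is isolated in $\sigma(T)$. Then $$\sigma_{ec}(T)\subset\sigma_{ap}(T)=\sigma_{gKR}(T)=\sigma_{gK}(T)=\sigma_{Kt}(T)=\sigma_{eK}(T)=\sigma_K(T)=\sigma_{\mathbf{gDR}\mathcal M}(T).$$
   Context: $\sigma_{ap}(T)$ is the set of $\lambda$ with $T-\lambda$ not bounded below (not injective with closed range); $\sigma_{ec}(T)=\{\lambda: R(T-\lambda)\text{ not closed}\}$. $S$ is Kato if $R(S)$ is closed and $N(S)\subset R(S^n)$ for all $n$; $S$ is Riesz if $S-\lambda$ is Fredholm for all $\lambda\ne0$. For an operator $S$ and closed $S$-invariant $M,N$ with $X=M\oplus N$ and $S_M$ Kato: if $S_N$ is Riesz, $S$ admits a GKRD; if $S_N$ is quasinilpotent, a GKD; if $S_N$ is nilpotent, $S$ is of Kato type; if $N$ is finite-dimensional and $S_N$ nilpotent, $S$ is essentially Kato. $\sigma_{gKR}$, $\sigma_{gK}$, $\sigma_{Kt}$, $\sigma_{eK}$, $\sigma_K$: sets of $\lambda$ with $T-\lambda$ not admitting a GKRD, not admitting a GKD, not of Kato type, not essentially Kato, not Kato. $\sigma_{\mathbf{gDR}\mathcal M}(T)$ is the set of $\lambda$ for which there are no closed $(T-\lambda)$-invariant $M,N$ with $X=M\oplus N$, $(T-\lambda)_M$ bounded below and $(T-\lambda)_N$ Riesz. *)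

(* Defs.v *)
From HB Require Import structures.
From mathcomp Require Import all_boot all_algebra.
From mathcomp Require Import all_classical all_reals all_analysis.
From mathcomp Require Import complex.
Set Implicit Arguments. Unset Strict Implicit. Unset Printing Implicit Defensive.
Import GRing.Theory Num.Theory.
Import numFieldNormedType.Exports.
Local Open Scope ring_scope.
Local Open Scope classical_set_scope.

Definition CC (R : realType) : numClosedFieldType := R[i].

Section Operators.
Variables (R : realType) (X : completeNormedModType (CC R)).
Local Notation K := (CC R).

Definition lsubspace (M : set X) : Prop :=
  M 0 /\ forall (a : K) (x y : X), M x -> M y -> M (a *: x + y).

Definition fin_dim (M : set X) : Prop :=
  exists s : seq X, (forall v, v \in s -> M v) /\
    forall x, M x -> exists c : 'I_(size s) -> K, x = \sum_(i < size s) c i *: s`_i.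

Definition shift (S : X -> X) (l : K) : X -> X := fun x => S x - l *: x.

Definition invariant (S : X -> X) (M : set X) : Prop := forall x, M x -> M (S x).

(* Restriction S_N : N -> N (N closed invariant subspace) is invertible in L(N):
   a continuous (on N) two-sided inverse mapping N into N. *)
Definition invertible_on (S : X -> X) (N : set X) : Prop :=
  exists g : X -> X, (forall y, N y -> N (g y)) /\ {within N, continuous g} /\
    (forall x, N x -> g (S x) = x) /\ (forall y, N y -> S (g y) = y).

Definition spectrum (T : X -> X) : set K := [set l | ~ invertible_on (shift T l) setT].

Definition bounded_below_on (S : X -> X) (M : set X) : Prop :=
  {in M &, injective S} /\ closed (S @` M).

Definition Kato_on (S : X -> X) (M : set X) : Prop :=
  closed (S @` M) /\
  forall n : nat, [set x | M x /\ S x = 0] `<=` (iter n S) @` M.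

Definition Fredholm_on (S : X -> X) (N : set X) : Prop :=
  fin_dim [set x | N x /\ S x = 0] /\ closed (S @` N) /\
  exists s : seq X, (forall v, v \in s -> N v) /\
    forall y, N y -> exists x, exists c : 'I_(size s) -> K,
      N x /\ y = S x + \sum_(i < size s) c i *: s`_i.

Definition Riesz_on (S : X -> X) (N : set X) : Prop :=
  forall mu : K, mu != 0 -> Fredholm_on (shift S mu) N.

Definition quasinilpotent_on (S : X -> X) (N : set X) : Prop :=
  forall mu : K, mu != 0 -> invertible_on (shift S mu) N.

Definition nilpotent_on (S : X -> X) (N : set X) : Prop :=
  exists n : nat, forall x, N x -> iter n S x = 0.

Definition reducing_pair (S : X -> X) (M N : set X) : Prop :=
  lsubspace M /\ lsubspace N /\ closed M /\ closed N /\
  invariant S M /\ invariant S N /\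
  (M `&` N = [set 0]) /\ (forall x, exists m n, M m /\ N n /\ x = m + n).

Definition Kato (S : X -> X) := Kato_on S setT.
Definition has_GKRD (S : X -> X) :=
  exists M N, reducing_pair S M N /\ Kato_on S M /\ Riesz_on S N.
Definition has_GKD (S : X -> X) :=
  exists M N, reducing_pair S M N /\ Kato_on S M /\ quasinilpotent_on S N.
Definition Kato_type (S : X -> X) :=
  exists M N, reducing_pair S M N /\ Kato_on S M /\ nilpotent_on S N.
Definition essentially_Kato (S : X -> X) :=
  exists M N, reducing_pair S M N /\ Kato_on S M /\ fin_dim N /\ nilpotent_on S N.
Definition has_gDR (S : X -> X) :=
  exists M N, reducing_pair S M N /\ bounded_below_on S M /\ Riesz_on S N.

Definition sigma_ap (T : X -> X) : set K := [set l | ~ bounded_below_on (shift T l) setT].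
Definition sigma_ec (T : X -> X) : set K := [set l | ~ closed (range (shift T l))].
Definition sigma_gKR (T : X -> X) : set K := [set l | ~ has_GKRD (shift T l)].
Definition sigma_gK (T : X -> X) : set K := [set l | ~ has_GKD (shift T l)].
Definition sigma_Kt (T : X -> X) : set K := [set l | ~ Kato_type (shift T l)].
Definition sigma_eK (T : X -> X) : set K := [set l | ~ essentially_Kato (shift T l)].
Definition sigma_K (T : X -> X) : set K := [set l | ~ Kato (shift T l)].
Definition sigma_gDRM (T : X -> X) : set K := [set l | ~ has_gDR (shift T l)].

End Operators.

Definition cboundary (R : realType) (A : set (CC R)) : set (CC R) :=
  closure A `\` interior A.

Definition isolated_in (R : realType) (A : set (CC R)) (l : CC R) : Prop :=
  A l /\ exists e : CC R, 0 < e /\ forall mu, A mu -> `|mu - l| < e -> mu = l.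

(* Main.v *)
(** A GKRD of [T - l] at a point of [sigma_ap T = ∂sigma(T)] is impossible, because it would
    isolate a point of [sigma_ap T].  First, [sigma_ap T] is contained in [sigma(T)] and equals
    its boundary, so it contains no disc; and since a punctured disc is connected, a point that
    is isolated in [∂sigma(T)] is isolated in [sigma(T)], so [sigma_ap T] has no isolated point.
    Let [X = M ⊕ N] with [(T - l)_M] Kato and [(T - l)_N] Riesz.  A nonzero kernel vector of a
    Kato operator extends to eigenvectors for all nearby eigenvalues, giving a disc in
    [sigma_ap T]; so [(T - l)_M] is bounded below, and remains so near [l].  Pick [m <> l] near
    [l] in [sigma_ap T].  Then [V = (T - m)_N] is Fredholm: either its kernel meets the
    intersection of the ranges [R(V^n)], and again there is a disc of eigenvalues, or [V] is
    injective on some closed [R(V^p)], and then [V - z] is bounded below for all small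
    [z <> 0], so that [m] is isolated in [sigma_ap T]. *)
Require Import Defs.
From HB Require Import structures.
From mathcomp Require Import all_boot all_order all_algebra.
From mathcomp Require Import all_classical all_reals all_analysis.
From mathcomp Require Import complex.
From mathcomp Require Import ring lra.
Import numFieldNormedType.Exports.
Local Open Scope ring_scope.
Local Open Scope classical_set_scope.

Set Implicit Arguments. Unset Strict Implicit. Unset Printing Implicit Defensive.
Import Order.TTheory GRing.Theory Num.Theory.

(* Norms over [CC R] take values in [CC R]; [nm] is the real-valued version. *)
Definition nm (R : realType) (V : normedZmodType (CC R)) (x : V) : R :=
  complex.Re (`|x| : R[i]).

(** * Real-valued norms, and completeness along sequences with halving steps *)

Section RealNorm.
Context {R : realType}.

Lemma nmE (V : normedZmodType (CC R)) (x : V) : (nm x)%:C%C = `|x| :> CC R.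
Proof. exact/RRe_real/normr_real. Qed.

Lemma nm_ge0 (V : normedZmodType (CC R)) (x : V) : 0 <= nm x.
Proof. by rewrite -ler0c nmE; exact: normr_ge0. Qed.

Lemma nm0 (V : normedZmodType (CC R)) : nm (0 : V) = 0.
Proof. by rewrite /nm normr0. Qed.

Lemma nm_eq0 (V : normedZmodType (CC R)) (x : V) : nm x = 0 -> x = 0.
Proof. by move=> x0; apply/normr0_eq0; rewrite -nmE x0. Qed.

Lemma nm_gt0 (V : normedZmodType (CC R)) (x : V) : x != 0 -> 0 < nm x.
Proof.
by move=> x0; rewrite lt_neqAle nm_ge0 andbT eq_sym; apply: contra x0 => /eqP/nm_eq0 ->.
Qed.

Lemma nmN (V : normedZmodType (CC R)) (x : V) : nm (- x) = nm x.
Proof. by rewrite /nm normrN. Qed.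

Lemma nmB (V : normedZmodType (CC R)) (x y : V) : nm (x - y) = nm (y - x).
Proof. by rewrite -nmN opprB. Qed.

Lemma nm_triangle (V : normedZmodType (CC R)) (x y : V) : nm (x + y) <= nm x + nm y.
Proof. by rewrite -lecR rmorphD /= !nmE; exact: ler_normD. Qed.

Lemma nm_sub (V : normedZmodType (CC R)) (x y : V) : nm (x - y) <= nm x + nm y.
Proof. by rewrite -(nmN y) nm_triangle. Qed.

Lemma nm_split (V : normedZmodType (CC R)) (y x z : V) :
  nm (x - z) <= nm (x - y) + nm (y - z).
Proof. by rewrite (le_trans _ (nm_triangle _ _))// addrA subrK. Qed.

Lemma nmZ (V : normedModType (CC R)) (a : CC R) (x : V) : nm (a *: x) = nm a * nm x.
Proof. by apply: (@complexI R); rewrite rmorphM /= !nmE normrZ. Qed.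

Lemma nmM (a b : CC R) : nm (a * b) = nm a * nm b.
Proof. by apply: (@complexI R); rewrite rmorphM /= !nmE normrM. Qed.

Lemma nm_real (t : R) : 0 <= t -> nm (t%:C%C : CC R) = t.
Proof. by move=> t0; rewrite /nm ger0_norm// ler0c. Qed.

Lemma nm_lt (V : normedZmodType (CC R)) (x : V) (e : R) :
  (`|x| < e%:C%C :> CC R) = (nm x < e).
Proof. by rewrite -nmE; exact: ltcR. Qed.

Lemma pos_complexE (e : CC R) : 0 < e -> exists2 d : R, 0 < d & e = d%:C%C.
Proof.
move=> e0; exists (complex.Re e).
  by move: e0; rewrite ltcE /= => /andP[].
by rewrite RRe_real//; exact: gtr0_real.
Qed.

Lemma le_eps0 (x : R) : (forall e, 0 < e -> x <= e) -> x <= 0.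
Proof. by move=> h; apply/ler_addgt0Pl => e e0; rewrite addr0 h. Qed.

Lemma half_pow (r : nat -> R) : (forall n, r n.+1 <= r n / 2) ->
  forall n k, r (n + k)%N <= r n / 2 ^+ k.
Proof.
move=> rS n; elim=> [|k IH]; first by rewrite addn0 expr0 divr1.
rewrite addnS (le_trans (rS _))// exprSr invfM mulrA ler_pM2r//.
Qed.

Lemma half_small (r : nat -> R) : (forall n, r n.+1 <= r n / 2) ->
  forall e, 0 < e -> exists N, forall n, (N <= n)%N -> r n < e.
Proof.
move=> rS e e0; pose N := Num.bound (`|r 0%N| / e); exists N => n Nn.
have := half_pow rS 0 n; rewrite add0n => /le_lt_trans; apply.
rewrite ltr_pdivrMr ?exprn_gt0// (le_lt_trans (ler_norm _))//.
rewrite -ltr_pdivrMl// mulrC.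
have := archi_boundP (divr_ge0 (normr_ge0 (r 0%N)) (ltW e0)).
move=> /lt_le_trans; apply; rewrite -natrX ler_nat.
exact: leq_trans (ltnW (ltn_expl _ _)) (leq_pexp2l _ Nn).
Qed.

(* Sequential completeness, restricted to sequences with at least geometric convergence. *)
Definition hcomplete (V : normedZmodType (CC R)) (M : set V) :=
  forall (u : nat -> V) (r : nat -> R), (forall n, M (u n)) ->
    (forall n, nm (u n.+1 - u n) <= r n / 2) -> (forall n, r n.+1 <= r n / 2) ->
  exists2 l, M l & forall n, nm (l - u n) <= r n.

Lemma half_ge0 (V : normedZmodType (CC R)) (u : nat -> V) (r : nat -> R) :
  (forall n, nm (u n.+1 - u n) <= r n / 2) -> forall n, 0 <= r n.
Proof. by move=> ur n; have := nm_ge0 (u n.+1 - u n); have := ur n; lra. Qed.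

(** As [r n.+1 <= r n / 2], a step of size [r n / 2] is at most [r n - r n.+1], and these
    differences telescope. *)
Lemma half_dist (V : normedZmodType (CC R)) (u : nat -> V) (r : nat -> R) :
  (forall n, nm (u n.+1 - u n) <= r n / 2) -> (forall n, r n.+1 <= r n / 2) ->
  forall n k, nm (u (n + k)%N - u n) <= r n - r (n + k)%N.
Proof.
move=> ur rS n; elim=> [|k IH]; first by rewrite addn0 !subrr nm0.
have := nm_split (u (n + k)%N) (u (n + k).+1) (u n); rewrite addnS.
by have := ur (n + k)%N; have := rS (n + k)%N; lra.
Qed.

Lemma geom_half (c : R) n : c / 2 ^+ n.+1 = c / 2 ^+ n / 2.
Proof. by rewrite exprSr invfM mulrA. Qed.

Lemma hcomplete_closure (V : normedZmodType (CC R)) (M : set V) (x : V) :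
  hcomplete M -> (forall e, 0 < e -> exists2 y, M y & nm (y - x) < e) -> M x.
Proof.
move=> cM ax; pose r n : R := 1 / 2 ^+ n.
have r0 n : 0 < r n by rewrite divr_gt0// exprn_gt0.
have rS n : r n.+1 = r n / 2 by rewrite /r geom_half.
(* With tolerance [r n / 4], consecutive points differ by at most [r n / 4 + r n / 8], within the
   required [r n / 2]. *)
have /choice[u uP] n : exists y, M y /\ nm (y - x) < r n / 4.
  by have [|y My yx] := ax (r n / 4); [rewrite divr_gt0|exists y].
have [||n|l Ml lu] := cM u r; first by move=> n; have [] := uP n.
- move=> n; have [_ h1] := uP n; have [_ h2] := uP n.+1.
  have := nm_split x (u n.+1) (u n); rewrite (nmB x).
  by rewrite rS in h2; have := r0 n; lra.
- by rewrite rS.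
suff -> : x = l by [].
apply/eqP; rewrite eq_sym -subr_eq0; apply/eqP/nm_eq0/le_anti.
rewrite nm_ge0 andbT; apply: le_eps0 => e e0.
have [||N /(_ N (leqnn _)) rN] := @half_small r _ (e / 2); first by move=> n; rewrite rS.
  by rewrite divr_gt0.
have [_ h1] := uP N; have := nm_split (u N) l x; have := lu N; have := r0 N; lra.
Qed.

Lemma closedP (V : normedModType (CC R)) (M : set V) :
  closed M <-> forall x, (forall e, 0 < e -> exists2 y, M y & nm (y - x) < e) -> M x.
Proof.
split=> [cM x ax|cM x clx].
  apply: cM => B /nbhs_ballP[e /= /pos_complexE[d d0 ->]] dB.
  have [y My yx] := ax d d0; exists y; split => //; apply: dB.
  by rewrite -ball_normE /= nm_lt nmB.
apply: cM => e e0; have e0C : (0 : CC R) < e%:C%C by rewrite ltcR.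
have [y [My]] := clx _ (nbhsx_ballx x _ e0C).
by rewrite -ball_normE /= nm_lt nmB => yx; exists y.
Qed.

Lemma hcomplete_closed (V : normedModType (CC R)) (M : set V) : hcomplete M -> closed M.
Proof. by move=> cM; apply/closedP => x; exact: hcomplete_closure. Qed.

Lemma closed_hcomplete (V : completeNormedModType (CC R)) (M : set V) :
  closed M -> hcomplete M.
Proof.
move=> /closedP cM u r Mu ur rS.
have r0 := half_ge0 ur; have uk := half_dist ur rS.
have /cauchy_cvg cu : cauchy (u @ \oo).
  apply: cauchy_exP => e /pos_complexE[d d0 ->].
  have [N rN] := half_small rS d0; exists (u N); exists N => // n Nn.
  rewrite -ball_normE /= nm_lt nmB.
  rewrite /= in Nn.
  by have := uk N (n - N)%N; rewrite subnKC//; have := rN N (leqnn _); have := r0 n; lra.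
pose l := lim (u @ \oo).
have lu e : 0 < e -> forall n, exists2 k, (n <= k)%N & nm (u k - l) < e.
  move=> e0 n; have e0C : (0 : CC R) < e%:C%C by rewrite ltcR.
  have [N _ NP] := cu _ (nbhsx_ballx l _ e0C).
  exists (maxn n N); first exact: leq_maxl.
  by have := NP (maxn n N) (leq_maxr _ _); rewrite /= -ball_normE /= nm_lt nmB.
exists l.
  by apply: cM => e e0; have [k _ kl] := lu e e0 0%N; exists (u k).
move=> n; apply/ler_addgt0Pr => e e0; have [k nk kl] := lu e e0 n.
have := nm_split (u k) l (u n); rewrite (nmB l (u k)); have := uk n (k - n)%N.
by rewrite subnKC//; have := r0 k; lra.
Qed.

Lemma nm_pair (V W : normedModType (CC R)) (x : V * W) :
  nm x = Num.max (nm x.1) (nm x.2).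
Proof.
apply: (@complexI R); rewrite nmE prod_normE -!nmE.
by case: (leP (nm x.1) (nm x.2)) => h; [rewrite max_r// lecR|rewrite max_l// lecR ltW].
Qed.

Lemma hcomplete_setX (V W : normedModType (CC R)) (M : set V) (N : set W) :
  hcomplete M -> hcomplete N -> hcomplete (M `*` N).
Proof.
move=> cM cN u r MNu ur rS.
have [|n|//|l1 Ml1 lu1] := cM (fun n => (u n).1) r; first by move=> n; case: (MNu n).
  by apply: le_trans (ur n); rewrite nm_pair /= le_max lexx.
have [|n|//|l2 Nl2 lu2] := cN (fun n => (u n).2) r; first by move=> n; case: (MNu n).
  by apply: le_trans (ur n); rewrite nm_pair /= le_max lexx orbT.
by exists (l1, l2) => //= n; rewrite nm_pair ge_max lu1 lu2.
Qed.

(** The intervals with centre [u n] and radius [r n] meet pairwise, so the supremum of their left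
    ends lies in all of them. *)
Lemma hcomplete_real (u r : nat -> R) :
  (forall n, `|u n.+1 - u n| <= r n / 2) -> (forall n, r n.+1 <= r n / 2) ->
  exists l, forall n, `|l - u n| <= r n.
Proof.
move=> ur rS.
have r0 n : 0 <= r n by have := normr_ge0 (u n.+1 - u n); have := ur n; lra.
have uk n k : `|u (n + k)%N - u n| <= r n - r (n + k)%N.
  elim: k => [|k IH]; first by rewrite addn0 !subrr normr0.
  have := ler_distD (u (n + k)%N) (u (n + k).+1) (u n); rewrite addnS.
  have := ur (n + k)%N; have := rS (n + k)%N; lra.
have lo_up m n : u m - r m <= u n + r n.
  case: (leqP m n) => [mn|/ltnW nm].
    by have := uk m (n - m)%N; rewrite subnKC// ler_norml; have := r0 n; lra.
  by have := uk n (m - n)%N; rewrite subnKC// ler_norml; have := r0 m; lra.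
pose A : set R := [set u n - r n | n in setT].
have supA : has_sup A.
  by split; [exists (u 0%N - r 0%N), 0%N|exists (u 0%N + r 0%N) => _ [n _ <-]].
exists (sup A) => n; rewrite ler_distl; apply/andP; split.
  by apply: ub_le_sup; [case: supA|exists n].
by apply: ge_sup => [|_ [m _ <-]]; [case: supA|].
Qed.

Lemma hcomplete_CC : hcomplete [set: CC R].
Proof.
have nmRe (z : CC R) : `|complex.Re (z : R[i])| <= nm z.
  rewrite -lecR nmE; exact: normc_ge_Re.
have nmIm (z : CC R) : `|complex.Im (z : R[i])| <= nm z.
  have := nmRe ((z : R[i]) * 'i%C); rewrite ReiNIm normrN nmM => /le_trans; apply.
  suff -> : nm ('i%C : CC R) = 1 by rewrite mulr1.
  by rewrite /nm normc_def /= expr0n add0r expr1n sqrtr1.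
have nmC (z : CC R) : nm z <= `|complex.Re (z : R[i])| + `|complex.Im (z : R[i])|.
  rewrite -lecR nmE {1}[z : R[i]]complexE rmorphD /=.
  apply: le_trans (ler_normD _ _) _; rewrite normrM.
  rewrite !normc_def /= expr0n !addr0 !sqrtr_sqr add0r expr1n sqrtr1 mul1r//.
move=> u r _ ur rS.
have [|a au] := @hcomplete_real (fun n => complex.Re (u n : R[i])) r _ rS.
  by move=> n; apply: le_trans (ur n); apply: le_trans (nmRe _); rewrite raddfB.
have [|b bu] := @hcomplete_real (fun n => complex.Im (u n : R[i])) r _ rS.
  by move=> n; apply: le_trans (ur n); apply: le_trans (nmIm _); rewrite raddfB.
pose l : CC R := (a +i* b)%C; exists l => // n.
(* Adding the two coordinate bounds loses a factor 2; passing through a far term [u (n + N)] then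
   recovers the radius [r n]. *)
have lu k : nm (l - u k) <= 2 * r k.
  have := nmC (l - u k); rewrite !raddfB /=; have := au k; have := bu k; lra.
have r0 := half_ge0 ur; have uk := half_dist ur rS n.
apply/ler_addgt0Pr => e e0; have [N rN] := half_small rS e0.
have := nm_split (u (n + N)%N) l (u n); have := uk N; have := lu (n + N)%N.
have := rN _ (leq_addl n N); lra.
Qed.
End RealNorm.

(** * Baire category, the open mapping theorem on complete subspaces, and eigenvectors from chains
    of preimages *)

Section Banach.
Context {R : realType}.
Local Notation K := (CC R).

(** The condition of [lsubspace] over an arbitrary module, so that it also covers subspaces of a
    product. *)
Definition lsub (V : lmodType K) (M : set V) : Prop :=
  M 0 /\ forall (a : K) (x y : V), M x -> M y -> M (a *: x + y).

Definition blin (E F : normedModType K) (f : E -> F) : Prop :=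
  linear f /\ exists2 C : R, 0 < C & forall x, nm (f x) <= C * nm x.

Section LSub.
Variables (V : lmodType K) (M : set V).
Hypothesis lM : lsub M.

Lemma lsub0 : M 0. Proof. by case: lM. Qed.

Lemma lsubZ (a : K) x : M x -> M (a *: x).
Proof. by case: lM => M0 Ml Mx; rewrite -[_ *: _]addr0; exact: Ml. Qed.

Lemma lsubD x y : M x -> M y -> M (x + y).
Proof. by case: lM => _ Ml; rewrite -{2}[x]scale1r; exact: Ml. Qed.

Lemma lsubN x : M x -> M (- x).
Proof. by rewrite -scaleN1r; exact: lsubZ. Qed.

Lemma lsubB x y : M x -> M y -> M (x - y).
Proof. by move=> Mx My; apply: lsubD => //; exact: lsubN. Qed.

Lemma lsub_sum (u : nat -> V) n : (forall k, M (u k)) -> M (\sum_(k < n) u k).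
Proof. by move=> Mu; apply: big_ind; [exact: lsub0|exact: lsubD|]. Qed.
End LSub.

Section LinearFacts.
Variables (E F : lmodType K) (f : E -> F).
Hypothesis lf : linear f.

Lemma linD x y : f (x + y) = f x + f y.
Proof. by rewrite -{1}[x]scale1r lf scale1r. Qed.

Lemma lin0 : f 0 = 0.
Proof. by apply: (addrI (f 0)); rewrite -linD !addr0. Qed.

Lemma linZ (a : K) x : f (a *: x) = a *: f x.
Proof. by rewrite -[a *: x]addr0 lf lin0 addr0. Qed.

Lemma linN x : f (- x) = - f x.
Proof. by rewrite -scaleN1r linZ scaleN1r. Qed.

Lemma linB x y : f (x - y) = f x - f y.
Proof. by rewrite linD linN. Qed.

Lemma lsub_image (M : set E) : lsub M -> lsub (f @` M).
Proof.
move=> lM; split; first by exists 0; [exact: lsub0|exact: lin0].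
move=> a _ _ [x Mx <-] [y My <-]; exists (a *: x + y); last exact: lf.
by case: lM => _; apply.
Qed.
End LinearFacts.

(** Baire category. Otherwise each ball of [Y] contains a closed ball of at most half its radius
    that misses [A n]; the centres of the nested balls converge to a point of [Y] lying in no
    [A n]. *)
Lemma baire_hcomplete (V : normedModType K) (Y : set V) (A : nat -> set V) :
  hcomplete Y -> Y !=set0 -> (forall y, Y y -> exists n, A n y) ->
  exists n y (r : R), [/\ 0 < r, Y y & forall x, Y x -> nm (x - y) < r ->
    forall e, 0 < e -> exists2 a, A n a & nm (x - a) < e].
Proof.
move=> cY [y0 Yy0] YA; apply: contrapT => H.
have step (p : nat * (V * R)) : exists q : V * R, Y p.2.1 -> 0 < p.2.2 ->
    [/\ Y q.1, 0 < q.2, nm (q.1 - p.2.1) <= p.2.2 / 2, q.2 <= p.2.2 / 2 &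
     forall x, nm (x - q.1) <= q.2 -> ~ A p.1 x].
  case: p => n [y r] /=.
  have [[Yy r0]|nYr] := pselect (Y y /\ 0 < r); last first.
    by exists (0, 0) => Yy r0; exfalso; exact: nYr.
  apply: contrapT => /forallNP H'; apply: H; exists n, y, (r / 2); split=> //; first lra.
  move=> x Yx xy e e0; apply: contrapT => H2.
  (* The bound [r / 2] makes the radii halve, and [e / 2] keeps the new closed ball away from
     [A n]. *)
  apply: (H' (x, Num.min (r / 2) (e / 2))) => _ _ /=.
  have m1 : Num.min (r / 2) (e / 2) <= r / 2 by rewrite ge_min lexx.
  have m2 : Num.min (r / 2) (e / 2) <= e / 2 by rewrite ge_min lexx orbT.
  split=> //; first by rewrite lt_min; lra.
    exact: ltW.
  by move=> z zx Az; apply: H2; exists z => //; rewrite nmB; lra.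
have [g gP] := choice step.
pose s := fix s n : V * R := if n is k.+1 then g (k, s k) else (y0, 1).
have sP n : Y (s n).1 /\ 0 < (s n).2.
  elim: n => [|n [Yn rn]]; first by split => //=; exact: ltr01.
  by have [] := gP (n, s n) Yn rn.
have [||n|l Yl ls] := cY (fun n => (s n).1) (fun n => (s n).2).
- by move=> n; have [] := sP n.
- by move=> n; have [Yn rn] := sP n; have [] := gP (n, s n) Yn rn.
- by have [Yn rn] := sP n; have [] := gP (n, s n) Yn rn.
have [n An] := YA l Yl; have [Yn rn] := sP n.
by have [_ _ _ _ /(_ l)] := gP (n, s n) Yn rn; apply => //; exact: (ls n.+1).
Qed.

Section OpenMapping.
Variables (E F : normedModType K) (f : E -> F) (M : set E).
Hypotheses (lM : lsub M) (cM : hcomplete M) (bf : blin f) (cY : hcomplete (f @` M)).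

Lemma approx_preimage : exists2 C : R, 0 < C & forall w, (f @` M) w ->
  exists x, [/\ M x, nm x <= C * nm w & nm (w - f x) <= nm w / 2].
Proof.
have lf : linear f by case: bf.
have lY := lsub_image lf lM.
pose A (n : nat) := f @` [set x | M x /\ nm x <= n%:R].
have [||n [y0 [r [r0 Yy0 near]]]] := @baire_hcomplete F (f @` M) A cY.
- by exists 0; exact: lsub0.
- move=> _ [x Mx <-]; exists (Num.bound (nm x)), x => //; split => //.
  exact/ltW/archi_boundP/nm_ge0.
have small w : (f @` M) w -> nm w < r -> forall e, 0 < e ->
    exists x, [/\ M x, nm x <= 2 * n%:R & nm (w - f x) < e].
  move=> Yw wr e e0; have e20 : 0 < e / 2 by lra.
  have [] := near (w + y0) _ _ _ e20; [exact: lsubD|by rewrite addrK|].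
  move=> _ [x1 [Mx1 x1n] <-] h1.
  have [] := near y0 _ _ _ e20; [by []|by rewrite subrr nm0|].
  move=> _ [x2 [Mx2 x2n] <-] h2.
  exists (x1 - x2); split; [exact: lsubB|by have := nm_sub x1 x2; lra|].
  have -> : w - f (x1 - x2) = (w + y0 - f x1) - (y0 - f x2).
    by rewrite (linB lf) !opprB (addrAC w) -[RHS]addrA subrKC -addrA (addrC (- _)).
  by have := nm_sub (w + y0 - f x1) (y0 - f x2); lra.
(* Scaling [w] to norm [r / 2] gives an approximate preimage of norm at most [2 * n]; scaling back
   multiplies by [2 * nm w / r]. The summand 1 keeps [C] positive when [n = 0]. *)
pose C : R := (4 * n%:R + 1) / r.
have n0 : 0 <= n%:R :> R by exact: ler0n.
exists C; first by apply: divr_gt0 => //; lra.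
move=> w Yw; have [->|w0] := eqVneq w 0.
  exists 0; split; first exact: lsub0; by rewrite ?(lin0 lf) ?subr0 !nm0 ?mulr0 ?mul0r.
have nw := nm_gt0 w0.
pose t : R := r / (2 * nm w).
have t0 : 0 < t by apply: divr_gt0 => //; lra.
have tw : t * nm w = r / 2 by rewrite /t; field; lra.
have nt : nm (t%:C%C : K) = t by rewrite nm_real// ltW.
have [|||x [Mx xn xe]] := small (t%:C%C *: w) _ _ (r / 4); first exact: lsubZ.
- by rewrite nmZ nt tw; lra.
- by lra.
have ntV : nm (t^-1%:C%C : K) = t^-1 by rewrite nm_real// invr_ge0 ltW.
have tV : t^-1 = 2 * nm w / r by rewrite /t invf_div.
exists (t^-1%:C%C *: x); split; first exact: lsubZ.
  rewrite nmZ ntV tV /C mulrAC [leRHS]mulrAC ler_pM2r ?invr_gt0//.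
  have := ler_wpM2l (ltW nw) xn; lra.
have -> : w - f (t^-1%:C%C *: x) = t^-1%:C%C *: (t%:C%C *: w - f x).
  by rewrite scalerBr -(linZ lf) scalerA -rmorphM /= mulVf ?gt_eqF// scale1r.
rewrite nmZ ntV.
have -> : nm w / 2 = t^-1 * (r / 4) by rewrite tV; field; lra.
by rewrite ler_pM2l ?invr_gt0// ltW.
Qed.

(** Successive approximation: the remainders [w n] halve, so the corrections [g (w n)] sum to an
    exact preimage, at the cost of doubling the constant. *)
Lemma open_mapping : exists2 C : R, 0 < C & forall y, (f @` M) y ->
  exists2 x, M x & f x = y /\ nm x <= C * nm y.
Proof.
have [lf [D D0 fD]] := bf; have lY := lsub_image lf lM.
have [C C0 step] := approx_preimage.
have /choice[g gP] w : exists x, (f @` M) w ->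
    [/\ M x, nm x <= C * nm w & nm (w - f x) <= nm w / 2].
  have [Yw|nYw] := pselect ((f @` M) w); last by exists 0 => /nYw.
  by have [x] := step w Yw; exists x.
exists (2 * C); first lra.
move=> y Yy; pose w n := iter n (fun w => w - f (g w)) y.
have wP n : (f @` M) (w n).
  elim: n => //= n IH; apply: (lsubB lY) => //; exists (g (w n)) => //.
  by have [] := gP _ IH.
pose u n := \sum_(k < n) g (w k).
have uS n : u n.+1 = u n + g (w n) by rewrite /u big_ord_recr.
have fu n : f (u n) = y - w n.
  elim: n => [|n IH]; first by rewrite /u big_ord0 (lin0 lf) subrr.
  by rewrite uS (linD lf) IH /= opprB addrA addrAC.
have Mu n : M (u n) by apply: (lsub_sum lM (u := g \o w)) => k; have [] := gP _ (wP k).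
have [n|n|x Mx xu] := @cM u (fun n => 2 * C * nm (w n)) Mu.
- rewrite uS addrAC subrr add0r; have [_ + _] := gP _ (wP n); lra.
- rewrite -[leRHS]mulrA ler_pM2l; last lra.
  by have [] := gP _ (wP n).
exists x => //; split; last by have := xu 0%N; rewrite /u big_ord0 subr0.
apply/eqP; rewrite -subr_eq0; apply/eqP/nm_eq0/le_anti; rewrite nm_ge0 andbT.
have wS n : nm (w n.+1) <= nm (w n) / 2 by have [] := gP _ (wP n).
(* The error [f x - y] is at most [D * nm (x - u N) + nm (w N)], that is, at most [B * nm (w N)]. *)
apply: le_eps0 => e e0; pose B := D * (2 * C) + 1.
have B0 : 0 < B by rewrite ltr_wpDl// mulr_ge0; lra.
have [|N /(_ N (leqnn _)) rN] := half_small wS (e := e / B); first exact: divr_gt0.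
have := nm_split (f (u N)) (f x) y; rewrite -(linB lf) fu addrAC subrr add0r nmN.
have := fD (x - u N); have := ler_wpM2l (ltW D0) (xu N).
move: rN; rewrite ltr_pdivlMr// /B => rN; lra.
Qed.
End OpenMapping.

(** By injectivity, the preimage of controlled norm supplied by [open_mapping] is [x] itself. *)
Lemma lower_bound (E F : normedModType K) (f : E -> F) (M : set E) :
  lsub M -> hcomplete M -> blin f -> hcomplete (f @` M) ->
  (forall x, M x -> f x = 0 -> x = 0) ->
  exists2 c : R, 0 < c & forall x, M x -> c * nm x <= nm (f x).
Proof.
move=> lM cM bf cY inj; have [lf _] := bf.
have [C C0 CP] := open_mapping lM cM bf cY.
exists C^-1; first by rewrite invr_gt0.
move=> x Mx; have [|y My [fyx ny]] := CP (f x); first by exists x.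
have -> : x = y.
  by apply/eqP; rewrite -subr_eq0; apply/eqP/inj; [exact: lsubB|rewrite (linB lf) fyx subrr].
by rewrite ler_pdivrMl// -fyx in ny *.
Qed.

(** The lower bound turns a halving sequence in the image into a halving sequence of preimages, with
    radii multiplied by [c^-1]. *)
Lemma hcomplete_image (E F : normedModType K) (f : E -> F) (M : set E) (c : R) :
  lsub M -> hcomplete M -> blin f -> 0 < c ->
  (forall x, M x -> c * nm x <= nm (f x)) -> hcomplete (f @` M).
Proof.
move=> lM cM [lf [D D0 fD]] c0 low u r Mu ur rS.
have r0 := half_ge0 ur.
have /choice[v vP] n : exists x, M x /\ f x = u n.
  by have [x Mx <-] := Mu n; exists x.
have Mv n : M (v n) by case: (vP n).
have fv n : f (v n) = u n by case: (vP n).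
have [n|n|x Mx xv] := cM v (fun n => c^-1 * r n) Mv.
- rewrite -mulrA ler_pdivlMl//; apply: le_trans (ur n).
  by rewrite -!fv -(linB lf); apply: low; exact: lsubB.
- by rewrite -mulrA ler_pM2l ?invr_gt0.
exists (f x); first by exists x.
move=> n; apply/ler_addgt0Pr => e e0; pose B := D / c.
have B0 : 0 < B by exact: divr_gt0.
have [|N NP] := half_small rS (e := e / B); first exact: divr_gt0.
have := half_dist ur rS n N; have := NP _ (leq_addl n N).
rewrite ltr_pdivlMr// => h1 h2.
have := nm_split (f (v (n + N)%N)) (f x) (u n); rewrite -(linB lf) fv.
have := fD (x - v (n + N)%N); have := ler_wpM2l (ltW D0) (xv (n + N)%N).
rewrite mulrA -/B => h3 h4; have := r0 (n + N)%N; lra.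
Qed.

(* The vectors [z ^+ n *: x n], where [x] is a chain of preimages of [x0] with
   geometrically bounded norms, sum to an eigenvector for every small [z]. *)
Lemma eigenvectors_near (E : completeNormedModType K) (f : E -> E) (P : set E) (C : R) (x0 : E) :
  blin f -> 0 < C ->
  (forall x, P x -> exists2 y, P y & f y = x /\ nm y <= C * nm x) ->
  P x0 -> f x0 = 0 -> x0 != 0 ->
  forall z : K, nm z * C <= 1 / 4 -> exists2 x, x != 0 & f x = z *: x.
Proof.
move=> [lf [D D0 fD]] C0 back Px0 fx0 x0n z zC.
have /choice[g gP] x : exists y, P x -> [/\ P y, f y = x & nm y <= C * nm x].
  have [Px|nPx] := pselect (P x); last by exists 0 => /nPx.
  by have [y Py []] := back x Px; exists y.
pose x n := iter n g x0.
have Px n : P (x n) by elim: n => //= n IH; have [] := gP _ IH.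
pose y n := z ^+ n *: x n.
have yS n : nm (y n.+1) <= nm (y n) / 4.
  rewrite /y !nmZ exprSr nmM; have [_ _ h] := gP _ (Px n).
  have h1 := ler_wpM2l (nm_ge0 z) h.
  have h2 := ler_wpM2r (nm_ge0 (x n)) zC.
  have h3 : nm z * nm (x n.+1) <= nm (x n) / 4 by rewrite /= in h1 *; lra.
  by have := ler_wpM2l (nm_ge0 (z ^+ n)) h3; rewrite !mulrA.
have fy n : f (y n.+1) = z *: y n.
  by rewrite /y (linZ lf) exprS -scalerA; have [_ -> _] := gP _ (Px n).
pose u n := \sum_(k < n.+1) y k.
have uS n : u n.+1 = u n + y n.+1 by rewrite /u big_ord_recr.
have u0 : u 0%N = x0 by rewrite /u big_ord1 /y expr0 scale1r.
(* [f] kills the first term [x0] and lowers the others, so the partial sums are eigenvectors up to a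
   shift of index. *)
have fu n : f (u n.+1) = z *: u n.
  elim: n => [|n IH]; last by rewrite uS (linD lf) IH fy -scalerDr -uS.
  by rewrite uS (linD lf) fy u0 fx0 add0r /y expr0 scale1r.
(* Starting at [nm x0 / 2] keeps the limit within that distance of [u 0 = x0], so it is nonzero. *)
pose r n := nm x0 / 2 ^+ n.+1.
have rS n : r n.+1 = r n / 2 by rewrite /r geom_half.
have yr n : nm (y n) <= 2 * r n.
  elim: n => [|n IH]; first by rewrite /y expr0 scale1r /r expr1 mulrCA divff// mulr1.
  by have := yS n; have := nm_ge0 (y n); rewrite rS; lra.
have [||n|l _ lu] := @closed_hcomplete _ E setT closedT u r; first by [].
- by move=> n; rewrite uS addrAC subrr add0r; have := yS n; have := yr n; lra.
- by rewrite rS.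
exists l.
  apply/eqP => l0; have := lu 0%N; rewrite l0 u0 sub0r nmN /r expr1.
  by have := nm_gt0 x0n; lra.
apply/eqP; rewrite -subr_eq0; apply/eqP/nm_eq0/le_anti; rewrite nm_ge0 andbT.
apply: le_eps0 => e e0; pose B := D + nm z.
have B0 : 0 < B by have := nm_ge0 z; rewrite /B; lra.
have [||N NP] := @half_small R r _ (e / B); first by move=> n; rewrite rS.
  exact: divr_gt0.
have := NP _ (leqnn N); rewrite ltr_pdivlMr// /B.
have := nm_split (f (u N.+1)) (f l) (z *: l); rewrite -(linB lf) fu -scalerBr nmZ (nmB _ l).
have := fD (l - u N.+1); have := ler_wpM2l (ltW D0) (lu N.+1).
have := ler_wpM2l (nm_ge0 z) (lu N); rewrite rS.
have r0 : 0 <= r N by rewrite divr_ge0 ?nm_ge0// exprn_ge0.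
have := mulr_ge0 (ltW D0) r0; lra.
Qed.

End Banach.

(** * Finite spans, their sums with complete subspaces, and their traces on decreasing subspaces *)

Section FiniteDimension.
Context {R : realType}.
Local Notation K := (CC R).

Fixpoint lspan (V : lmodType K) (s : seq V) : set V :=
  if s is v :: s' then [set x | exists a w, lspan s' w /\ x = a *: v + w] else [set 0].

Lemma lsub_lspan (V : lmodType K) (s : seq V) : lsub (lspan s).
Proof.
elim: s => [|v s [IH0 IH]] /=; first by split=> // a _ _ -> ->; rewrite scaler0 addr0.
split; first by exists 0, 0; rewrite scale0r addr0.
move=> a _ _ [b [x [sx ->]]] [c [y [sy ->]]]; exists (a * b + c), (a *: x + y).
by split; [exact: IH|rewrite scalerDr scalerDl scalerA addrACA].
Qed.

Lemma fin_dim_lspan (X : completeNormedModType K) (M : set X) :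
  lsub M -> fin_dim M -> exists s, M = lspan s.
Proof.
move=> lM [s [sM Ms]]; exists s; apply/seteqP; split.
  move=> x /Ms[c ->] {Ms sM x}; elim: s c => [|v s IH] c; first by rewrite big_ord0.
  rewrite big_ord_recl /=; exists (c ord0), (\sum_(i < size s) c (lift ord0 i) *: s`_i).
  by split => //; exact: IH.
move=> x; elim: s x sM {Ms} => [x _ ->|v s IH x sM [a [w [sw ->]]]]; first exact: lsub0.
apply: lsubD => //; first by apply: lsubZ => //; apply: sM; rewrite inE eqxx.
by apply: IH => // u us; apply: sM; rewrite inE us orbT.
Qed.

Lemma lsub_add_line (V : lmodType K) (Y : set V) (v : V) :
  lsub Y -> lsub [set x | exists a y, Y y /\ x = a *: v + y].
Proof.
move=> lY; split; first by exists 0, 0; rewrite scale0r addr0; split => //; exact: lsub0.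
move=> a _ _ [b [x [sx ->]]] [c [y [sy ->]]]; exists (a * b + c), (a *: x + y).
by split; [case: lY => _; exact|rewrite scalerDr scalerDl scalerA addrACA].
Qed.

(** If [v] is not in [Y], it has a positive distance [d] to [Y]. Then [a *: v + y] controls [a]
    through [d], and hence [y], so the addition map on the product is bounded below. *)
Lemma hcomplete_add_line (V : normedModType K) (Y : set V) (v : V) :
  lsub Y -> hcomplete Y -> hcomplete [set x | exists a y, Y y /\ x = a *: v + y].
Proof.
move=> lY cY; have [Yv|nYv] := pselect (Y v).
  suff -> : [set x | exists a y, Y y /\ x = a *: v + y] = Y by [].
  apply/seteqP; split=> [_ [a [y [Yy ->]]]|y Yy].
    by apply: lsubD => //; exact: lsubZ.
  by exists 0, y; rewrite scale0r add0r.
have [d d0 dP] : exists2 d : R, 0 < d & forall y, Y y -> d <= nm (y - v).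
  apply: contrapT => H; apply: nYv; apply: hcomplete_closure => // e e0.
  apply: contrapT => H2; apply: H; exists e => // y Yy; rewrite leNgt; apply/negP => h.
  by apply: H2; exists y.
pose f (p : K^o * V) : V := p.1 *: v + p.2.
have lf : linear f.
  move=> a [b x] [c y]; rewrite /f /= scalerDl -scalerA scalerDr addrACA //.
have fb p : nm (f p) <= (nm v + 1) * nm p.
  have := nm_triangle (p.1 *: v) p.2; rewrite -/(f p) nmZ => /le_trans; apply.
  have h1 : nm p.1 <= nm p by rewrite nm_pair le_max lexx.
  have h2 : nm p.2 <= nm p by rewrite nm_pair le_max lexx orbT.
  have := ler_wpM2r (nm_ge0 v) h1; lra.
have low a y : Y y -> d * nm a <= nm (a *: v + y).
  move=> Yy; have [->|a0] := eqVneq a 0; first by rewrite nm0 mulr0 nm_ge0.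
  have -> : a *: v + y = - a *: (- a^-1 *: y - v).
    by rewrite scalerBr scalerA mulrNN divff// scale1r scaleNr opprK addrC.
  by rewrite nmZ nmN mulrC ler_pM2l ?nm_gt0//; apply: dP; exact: lsubZ.
have -> : [set x | exists a y, Y y /\ x = a *: v + y] = f @` ([set: K^o] `*` Y).
  apply/seteqP; split=> [_ [a [y [Yy ->]]]|_ [[a y] [_ /= Yy] <-]]; first by exists (a, y).
  by exists a, y.
(* With [s = nm (a *: v + y)], one has [nm a <= s / d] and [nm y <= s + s / d * nm v]; [c^-1 * s] is
   the sum of the two bounds. *)
pose c : R := (1 + (1 + nm v) / d)^-1.
have v0 := nm_ge0 v.
have B0 : 0 <= (1 + nm v) / d by apply: divr_ge0; lra.
apply: (@hcomplete_image R _ _ f _ c) => //.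
- split; first by split => //; exact: lsub0.
  by move=> a [b x] [e y] [_ Yx] [_ Yy]; split => //=; case: lY => _; apply.
- by apply: hcomplete_setX => //; exact: hcomplete_CC.
- by split => //; exists (nm v + 1) => //; lra.
- by rewrite invr_gt0; lra.
move=> [a y] [_ /= Yy]; rewrite ler_pdivrMl; last lra.
have h1 := low a y Yy.
have h2 : nm y <= nm (a *: v + y) + nm a * nm v.
  by rewrite -nmZ -{1}[y](addKr (a *: v)) addrC -(nmN (a *: v)) nm_triangle.
have h3 : nm a <= nm (a *: v + y) / d by rewrite ler_pdivlMr// mulrC.
have h4 := ler_wpM2r v0 h3; have h5 := nm_ge0 (a *: v + y).
have h6 : 0 <= nm (a *: v + y) / d by rewrite divr_ge0// ltW.
have -> : (1 + (1 + nm v) / d) * nm (f (a, y)) = nm (a *: v + y) +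
   nm (a *: v + y) / d + nm (a *: v + y) / d * nm v by rewrite /f /=; field; lra.
have h7 : 0 <= nm (a *: v + y) / d * nm v by exact: mulr_ge0.
by rewrite nm_pair /= ge_max; apply/andP; split; lra.
Qed.

Lemma add_lspan (V : normedModType K) (s : seq V) (Y : set V) :
  lsub Y -> hcomplete Y ->
  lsub [set x | exists w y, [/\ lspan s w, Y y & x = w + y]] /\
  hcomplete [set x | exists w y, [/\ lspan s w, Y y & x = w + y]].
Proof.
elim: s Y => [|v s IH] Y lY cY.
  suff -> : [set x | exists w y, [/\ lspan [::] w, Y y & x = w + y]] = Y by [].
  apply/seteqP; split=> [_ [w [y [-> Yy ->]]]|y Yy]; first by rewrite add0r.
  by exists 0, y; rewrite add0r.
have -> : [set x | exists w y, [/\ lspan (v :: s) w, Y y & x = w + y]] =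
  [set x | exists w y, [/\ lspan s w, exists a z, Y z /\ y = a *: v + z & x = w + y]].
  apply/seteqP; split=> [_ [_ [y [[a [w [sw ->]]] Yy ->]]]|_ [w [_ [sw [a [z [Yz ->]]] ->]]]].
    by exists w, (a *: v + y); split => //; [exists a, y|rewrite addrA (addrC w)].
  by exists (a *: v + w), z; split => //; [exists a, w|rewrite addrA (addrC w)].
exact: IH (lsub_add_line v lY) (hcomplete_add_line lY cY).
Qed.

(** The traces on a finite span become stationary, by induction on [s]. If every [A n] meets
    [v + lspan s], a multiple of such a vector removes the [v] component and the index [p] for [s]
    still works; otherwise, from some [q] on, the coefficient of [v] must vanish. *)
Lemma decreasing_stable (V : lmodType K) (A : nat -> set V) (s : seq V) :
  (forall n, lsub (A n)) -> (forall n, A n.+1 `<=` A n) ->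
  exists p, forall n, (p <= n)%N -> lspan s `&` A p `<=` A n.
Proof.
move=> lA dA; have mA m n : (m <= n)%N -> A n `<=` A m.
  by elim: n => [|n IH]; [rewrite leqn0 => /eqP->|
    rewrite leq_eqVlt ltnS => /orP[/eqP-> //|/IH h] x /dA/h].
elim: s => [|v s [p pP]] /=.
  by exists 0%N => n _ x [-> _]; exact: lsub0.
have [H|/existsNP[q qP]] := pselect (forall n, exists w, lspan s w /\ A n (v + w)).
  exists p => n pn _ [[a [w [sw ->]]] Ax].
  have [w' [sw' Aw']] := H n.
  have -> : a *: v + w = (w - a *: w') + a *: (v + w').
    by rewrite scalerDr addrCA addrA addrA addrNK addrC.
  apply: lsubD => //; last exact: lsubZ.
  apply: pP => //; split.
    by apply: lsubB => //; [exact: lsub_lspan|apply: lsubZ => //; exact: lsub_lspan].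
  have -> : w - a *: w' = (a *: v + w) - a *: (v + w').
    by rewrite scalerDr opprD addrACA subrr add0r.
  by apply: lsubB => //; apply: lsubZ => //; exact: mA Aw'.
exists (maxn p q) => n; rewrite geq_max => /andP[pn qn] _ [[a [w [sw ->]]] Ax].
have [a0|a0] := eqVneq a 0.
  move: Ax; rewrite a0 scale0r add0r => Aw; apply: pP => //; split => //.
  exact: mA (leq_maxl p q) _ Aw.
exfalso; apply: qP; exists (a^-1 *: w); split; first exact: lsubZ (lsub_lspan _) _ _ _.
have -> : v + a^-1 *: w = a^-1 *: (a *: v + w).
  by rewrite scalerDr scalerA mulVf// scale1r.
by apply: lsubZ => //; exact: mA (leq_maxr p q) _ Ax.
Qed.
End FiniteDimension.

(** * Perturbation of an operator with closed range and finite-dimensional kernel *)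

Section SemiFredholm.
Context {R : realType} {X : completeNormedModType (CC R)}.
Local Notation K := (CC R).
Variables (f : X -> X) (N : set X) (s : seq X).
Hypotheses (bf : blin f) (lN : lsub N) (cN : closed N) (fN : Defs.invariant f N).
Hypotheses (cfN : closed (f @` N)) (kerN : [set x | N x /\ f x = 0] = lspan s).

(** Let [f x] be a limit of values [f z] with [z] in [Y]. By the open mapping theorem, [x] is a
    limit of points of the kernel plus [Y]; this sum is closed because the kernel is finitely
    spanned. *)
Lemma closed_image_sub (Y : set X) : lsub Y -> closed Y -> Y `<=` N -> closed (f @` Y).
Proof.
move=> lY cY YN; have [lf _] := bf.
have [C C0 CP] := open_mapping lN (closed_hcomplete cN) bf (closed_hcomplete cfN).
have kerP x : lspan s x <-> N x /\ f x = 0 by rewrite -kerN.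
have [lZ cZ] := add_lspan s lY (closed_hcomplete cY).
apply/closedP => y ay.
have [x Nx fx] : (f @` N) y.
  apply: (hcomplete_closure (closed_hcomplete cfN)) => e /ay[_ [z Yz <-] h].
  by exists (f z) => //; exists z => //; exact: YN.
have [w [z [sw Yz xwz]]] : [set x | exists w y, [/\ lspan s w, Y y & x = w + y]] x.
  apply: (hcomplete_closure cZ) => e e0.
  have [|_ [z Yz <-] zy] := ay (e / C); first exact: divr_gt0.
  have [|w Nw [fw nw]] := CP (f (z - x)).
    by exists (z - x) => //; apply: lsubB => //; exact: YN.
  exists (x + w); last first.
    rewrite addrAC subrr add0r; apply: le_lt_trans nw _.
    by move: zy; rewrite ltr_pdivlMr// (linB lf) fx mulrC.
  exists (x + w - z), z; split => //; last by rewrite subrK.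
  apply/kerP; split; first by apply: lsubB => //; [exact: lsubD|exact: YN].
  by rewrite (linB lf) (linD lf) fw (linB lf) subrKC subrr.
exists z => //; rewrite -fx xwz (linD lf); have [_ ->] := (kerP w).1 sw.
by rewrite add0r.
Qed.

Let iterR n := iter n f @` N.

Let iterRS n : iterR n.+1 = f @` iterR n.
Proof.
by apply/seteqP; split=> [_ [x Nx <-]|_ [_ [x Nx <-] <-]]; [exists (iter n f x) => //|];
  exists x.
Qed.

Let iterR_sub n : iterR n.+1 `<=` iterR n.
Proof. by move=> _ [x Nx <-]; exists (f x); [exact: fN|rewrite iterSr]. Qed.

Let iterRN n : iterR n `<=` N.
Proof. by move=> _ [x Nx <-]; elim: n => //= n; exact: fN. Qed.

Let iterR_lsub n : lsub (iterR n).
Proof.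
elim: n => [|n IH]; last by rewrite iterRS; apply: lsub_image => //; case: bf.
by rewrite /iterR image_id.
Qed.

Let iterR_closed n : closed (iterR n).
Proof.
elim: n => [|n IH]; first by rewrite /iterR image_id.
by rewrite iterRS; apply: closed_image_sub => //; exact: iterRN.
Qed.

Let iterR_mono m n : (m <= n)%N -> iterR n `<=` iterR m.
Proof.
elim: n => [|n IH]; first by rewrite leqn0 => /eqP->.
by rewrite leq_eqVlt ltnS => /orP[/eqP-> //|/IH h] x /iterR_sub/h.
Qed.

(** The decreasing ranges have a stationary trace on the finitely spanned kernel. *)
Let iterR_stable : exists p, forall x, f x = 0 -> iterR p x -> forall n, iterR n x.
Proof.
have [p pP] := decreasing_stable s iterR_lsub iterR_sub.
exists p => x fx px n; case: (leqP p n) => [pn|/ltnW np]; last exact: iterR_mono px.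
apply: pP => //; split => //; rewrite -kerN; split => //; exact: iterRN px.
Qed.

(** The intersection [P] of the ranges is closed and [f] maps it onto itself: preimages of [y] taken
    in [iterR p] and in a later range differ by a kernel vector of [iterR p], which lies in every
    range. Preimage chains from [x0] thus stay in [P] with bounded growth. *)
Lemma kernel_hyperrange_eigenvectors (x0 : X) : x0 != 0 -> f x0 = 0 ->
  (forall n, iterR n x0) ->
  exists2 e : R, 0 < e & forall z : K, nm z < e -> exists2 x, x != 0 & f x = z *: x.
Proof.
move=> x0n fx0 Rx0; have [lf _] := bf; have [p pP] := iterR_stable.
pose P := \bigcap_n iterR n.
have lP : lsub P.
  split; first by move=> n _; exact: lsub0.
  by move=> a x y Px Py n _; case: (iterR_lsub n) => _; apply; [exact: Px|exact: Py].
have cP : closed P by apply: closed_bigI => n _; exact: iterR_closed.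
have fP : f @` P = P.
  apply/seteqP; split=> [_ [x Px <-] n _|y Py].
    by apply: iterR_sub; rewrite iterRS; exists x => //; exact: Px.
  have /choice[u uP] n : exists x, iterR n x /\ f x = y.
    by have := Py n.+1 I; rewrite iterRS => -[x Rx xy]; exists x.
  have [Rp fp] := uP p; exists (u p) => // n _.
  case: (leqP n p) => [np|/ltnW pn]; first exact: iterR_mono Rp.
  have [Rn fn] := uP n; rewrite -(subrK (u n) (u p)); apply: lsubD => //.
  apply: pP; first by rewrite (linB lf) fp fn subrr.
  by apply: lsubB => //; exact: iterR_mono Rn.
have [||C C0 CP] := @open_mapping R X X f P lP _ bf; rewrite ?fP.
- exact: closed_hcomplete.
- exact: closed_hcomplete.
exists (C^-1 / 4); first by rewrite divr_gt0 ?invr_gt0.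
move=> z zC; apply: (@eigenvectors_near R X f P C x0) => //.
- by move=> x Px; apply: CP; rewrite fP.
- by rewrite -ler_pdivlMr//; lra.
Qed.

(** If no nonzero kernel vector lies in all ranges, [f] is injective on the closed space [iterR p],
    hence bounded below there. For small nonzero [z], [f x - z *: x] then controls both [iter p f x]
    and [iter p f x - z ^+ p *: x], and so [x]. *)
Lemma semi_fredholm_dichotomy :
  (exists2 e : R, 0 < e & forall z : K, nm z < e -> exists2 x, x != 0 & f x = z *: x) \/
  (exists2 e : R, 0 < e & forall z : K, z != 0 -> nm z < e ->
    exists2 c : R, 0 < c & forall x, N x -> c * nm x <= nm (f x - z *: x)).
Proof.
have [[x0 [x0n fx0 Rx0]]|noker] := pselect (exists x0, [/\ x0 != 0, f x0 = 0 &
    forall n, iterR n x0]); first by left; exact: kernel_hyperrange_eigenvectors fx0 Rx0.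
right; have [lf [D D0 fD]] := bf; have [p pP] := iterR_stable.
have [c c0 low] : exists2 c : R, 0 < c & forall x, iterR p x -> c * nm x <= nm (f x).
  apply: lower_bound => //; first exact: closed_hcomplete.
    by rewrite -iterRS; exact: closed_hcomplete.
  move=> x Rx fx; apply: contrapT => /eqP x0; apply: noker; exists x; split => //.
  exact: pP.
exists c => // z z0 zc.
have lit n : linear (iter n f).
  by elim: n => [|n IH] a x y //=; rewrite IH lf.
have itb n x : nm (iter n f x) <= D ^+ n * nm x.
  elim: n => [|n IH] /=; first by rewrite mul1r.
  by rewrite exprS -mulrA; apply: le_trans (fD _) _; rewrite ler_pM2l.
have [B B0 BP] : exists2 B : R, 0 <= B & forall x, 
    nm (iter p f x - z ^+ p *: x) <= B * nm (f x - z *: x).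
  elim: p {pP low} => [|n [B B0 IH]].
    by exists 0 => // x; rewrite /= expr0 scale1r subrr nm0 mul0r.
  have zn := nm_ge0 (z ^+ n).
  exists (D * B + nm (z ^+ n)); first by rewrite addr_ge0// mulr_ge0// ltW.
  move=> x; have -> : iter n.+1 f x - z ^+ n.+1 *: x =
      f (iter n f x - z ^+ n *: x) + z ^+ n *: (f x - z *: x).
    by rewrite (linB lf) (linZ lf) scalerBr scalerA -exprSr addrA subrK.
  have := nm_triangle (f (iter n f x - z ^+ n *: x)) (z ^+ n *: (f x - z *: x)).
  rewrite nmZ; have := fD (iter n f x - z ^+ n *: x).
  have := ler_wpM2l (ltW D0) (IH x); lra.
have zp0 : 0 < nm (z ^+ p) by rewrite nm_gt0// expf_neq0.
have Dp : 0 < D ^+ p by exact: exprn_gt0.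
pose c' := c - nm z; have c'0 : 0 < c' by rewrite subr_gt0.
pose A := D ^+ p / c' + B.
have A0 : 0 < A by rewrite ltr_wpDr// divr_gt0.
exists (nm (z ^+ p) / A); first exact: divr_gt0.
move=> x Nx; rewrite mulrAC ler_pdivrMr// -nmZ [leRHS]mulrC mulrDl.
have := nm_split (iter p f x) (z ^+ p *: x) 0; rewrite !subr0 (nmB (_ *: _)).
have := BP x; suff : nm (iter p f x) <= D ^+ p / c' * nm (f x - z *: x) by lra.
(* The iterate commutes with [f - z], which is bounded below by [c - nm z] on [iterR p]. *)
rewrite mulrAC ler_pdivlMr//; apply: le_trans (itb p _).
rewrite (linB (lit p)) (linZ (lit p)) -iterSr /= /c'.
have := low (iter p f x) (ex_intro2 _ _ x Nx erefl).
have := nm_split (z *: iter p f x) (f (iter p f x)) 0; rewrite !subr0 nmZ; lra.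
Qed.

End SemiFredholm.

(** * Boundaries of plane sets along segments and in punctured discs *)

Section ComplexPlane.
Context {R : realType}.
Local Notation K := (CC R).

(** Off the boundary, closure and interior agree, so the parameters whose points lie in [A] form a
    clopen subset of the connected interval from 0 to 1. *)
Lemma segment_boundary (A : set K) (a b : K) :
  (forall t : R, 0 <= t <= 1 -> ~ cboundary A (a + t%:C%C * (b - a))) -> A a -> A b.
Proof.
move=> nbd Aa; pose g (t : R) : K := a + t%:C%C * (b - a).
have cg : continuous g.
  move=> t; apply/cvg_ballP => _ /pos_complexE[e e0 ->].
  have B0 : 0 < nm (b - a) + 1 by rewrite ltr_wpDl ?nm_ge0.
  apply/nbhs_ballP; exists (e / (nm (b - a) + 1)); first exact: divr_gt0.
  move=> s; rewrite -!ball_normE /= nm_lt ltr_pdivlMr// => ts.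
  have -> : g t - g s = (t - s)%:C%C * (b - a).
    by rewrite /g opprD addrACA subrr add0r -mulrBl -rmorphB.
  have nts : nm ((t - s)%:C%C : K) = `|t - s|.
    by rewrite /nm normc_def /= expr0n addr0 sqrtr_sqr.
  rewrite nmM nts; apply: le_lt_trans ts; rewrite ler_wpM2l//; lra.
have gI t : 0 <= t <= 1 -> closure A (g t) -> interior A (g t).
  by move=> t01 clA; apply: contrapT => nint; exact: (nbd t t01).
have itv01 (t : R) : `[0, 1]%classic t <-> 0 <= t <= 1 by rewrite /= in_itv.
suff <- : g 1 = b.
  have /(_ [set t | `[0, 1]%classic t /\ A (g t)]) := @segment_connected R 0 1.
  move=> /(_ _ _ _)/seteqP[| | |_ /(_ 1)].
  - by exists 0; split; [apply/itv01; lra|rewrite /g mul0r addr0].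
  - exists (g @^-1` interior A); first by apply: open_comp => //; exact: open_interior.
    apply/seteqP; split=> t [t01 At]; split => //.
      by apply: gI; [exact/itv01|exact: subset_closure].
    exact: interior_subset At.
  - exists (g @^-1` closure A); first by apply: preimage_closed => //; exact: closed_closure.
    apply/seteqP; split=> t [t01 At]; split => //; first exact: subset_closure.
    by apply: interior_subset; apply: gI => //; exact/itv01.
  by case=> //; apply/itv01; lra.
by rewrite /g mul1r addrC subrK.
Qed.

Lemma nm_segment (a b : K) (e t : R) : 0 <= t <= 1 -> nm a < e -> nm b < e ->
  nm (a + t%:C%C * (b - a)) < e.
Proof.
move=> /andP[t0 t1] ae be.
have -> : a + t%:C%C * (b - a) = (1 - t)%:C%C * a + t%:C%C * b.
  by rewrite rmorphB /= mulrBr mulrBl mul1r addrCA addrC -addrA (addrC (- _)).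
have := nm_triangle ((1 - t)%:C%C * a) (t%:C%C * b).
rewrite !nmM !nm_real//; last lra.
have [->|] := eqVneq t 0; first lra.
move=> tn; have tp : 0 < t by rewrite lt_neqAle eq_sym tn.
have := ltr_pM2l tp (nm b) e; rewrite be => h1.
have h2 : (1 - t) * nm a <= (1 - t) * e by rewrite ler_wpM2l; lra.
lra.
Qed.

(* A set without boundary points in a punctured disc either contains the disc or misses it:
   two points are joined by a segment or, when the segment hits the centre, by two segments
   through the first point rotated by a right angle. *)
Lemma punctured_disc_boundary (A : set K) (l : K) (e : R) :
  (forall m, m != l -> nm (m - l) < e -> ~ cboundary A m) ->
  forall m m', m != l -> nm (m - l) < e -> m' != l -> nm (m' - l) < e -> A m -> A m'.
Proof.
move=> nbd.
have seg m m' : nm (m - l) < e -> nm (m' - l) < e ->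
    (forall t : R, 0 <= t <= 1 -> (m - l) + t%:C%C * (m' - m) != 0) -> A m -> A m'.
  move=> me me' mm'; apply: segment_boundary => t t01; apply: nbd.
    by apply: contra (mm' t t01) => /eqP <-; rewrite opprD addrA subrr add0r addNr.
  have -> : m + t%:C%C * (m' - m) - l = (m - l) + t%:C%C * ((m' - l) - (m - l)).
    by rewrite addrAC opprB addrA subrK.
  exact: nm_segment.
move=> m m' ml me ml' me' Am.
have [[t [t01 tmm]]|H] := pselect (exists t : R, 0 <= t <= 1 /\ (m - l) + t%:C%C * (m' - m) = 0);
  last first.
  by apply: (seg m) => // t t01; apply/eqP => h; apply: H; exists t.
pose n : K := l + 'i%C * (m - l).
have nlE : n - l = 'i%C * (m - l) by rewrite /n addrC addKr.
have ni : nm ('i%C : K) = 1 by rewrite /nm normc_def /= expr0n add0r expr1n sqrtr1.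
have ne : nm (n - l) < e by rewrite nlE nmM ni mul1r.
have ml0 : m - l != 0 by rewrite subr_eq0.
have subl x y : x - y = (x - l) - (y - l) :> K by rewrite opprB addrA subrK.
have nonreal (x y : R) : x%:C%C + y%:C%C * 'i%C = 0 :> K -> x = 0 /\ y = 0.
  by rewrite /=; simpc => -[].
apply: (seg n) => //; last first.
  apply: (seg m) => // s s01; apply/eqP => h.
  have : ((1 - s)%:C%C + s%:C%C * 'i%C) * (m - l) = 0.
    by rewrite -[RHS]h (subl n m) nlE rmorphB /=; ring.
  by move/eqP; rewrite mulf_eq0 (negbTE ml0) orbF => /eqP/nonreal[h1 h2]; lra.
move=> s s01; apply/eqP => h.
have t0 : t != 0.
  apply/eqP => t0; move: tmm; rewrite t0 mul0r addr0 => /eqP; rewrite (negbTE ml0)//.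
(* The centre lies on the segment from [m] to [m'], so [m' - l] is a real multiple of [m - l]. *)
have m'E : t%:C%C * (m' - l) = (t - 1)%:C%C * (m - l).
  apply/eqP; rewrite -subr_eq0; apply/eqP; rewrite -[RHS]tmm (subl m' m) rmorphB /=.
  by ring.
(* If the segment from [n] to [m'] also hits the centre, both real coordinates vanish; as [t != 0],
   this forces [s = 1], then [t = 1], and finally the excluded [m' = l]. *)
have : ((s * (t - 1))%:C%C + (t * (1 - s))%:C%C * 'i%C) * (m - l) = 0.
  transitivity (t%:C%C * ((n - l) + s%:C%C * (m' - n))); last by rewrite h mulr0.
  rewrite (subl m' n) nlE; set q := m' - l.
  have -> : t%:C%C * ('i%C * (m - l) + s%:C%C * (q - 'i%C * (m - l))) =
      (1 - s%:C%C) * (t%:C%C * 'i%C * (m - l)) + s%:C%C * (t%:C%C * q) :> K by ring.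
  by rewrite m'E !rmorphM !rmorphB /=; ring.
move/eqP; rewrite mulf_eq0 (negbTE ml0) orbF => /eqP/nonreal[h1 h2].
have s1 : s = 1.
  by move/eqP: h2; rewrite mulf_eq0 (negbTE t0) /= subr_eq0 => /eqP.
have t1 : t = 1 by move: h1; rewrite s1 mul1r; lra.
move: m'E; rewrite t1 mul1r subrr mul0r => /eqP; rewrite subr_eq0 (negbTE ml')//.
Qed.

(** A point of [A] in the punctured disc would bring the whole disc into [A], making [l] an interior
    point. *)
Lemma isolated_boundary (A : set K) (l : K) (e : R) : 0 < e -> A l -> cboundary A l ->
  (forall m, m != l -> nm (m - l) < e -> ~ cboundary A m) -> isolated_in A l.
Proof.
move=> e0 Al [_ nint] nbd; split => //; exists e%:C%C; split; first by rewrite ltcR.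
move=> m Am; rewrite nm_lt => me; apply: contrapT => /eqP ml; apply: nint.
apply/nbhs_ballP; exists e%:C%C; first by rewrite /= ltcR.
move=> m'; rewrite -ball_normE /= nm_lt nmB => me'.
have [->//|ml'] := eqVneq m' l.
exact: (punctured_disc_boundary nbd ml me ml' me' Am).
Qed.
End ComplexPlane.

(** * Shifts, lower bounds, Kato operators and reducing pairs *)

Section Operators.
Context {R : realType} {X : completeNormedModType (CC R)}.
Local Notation K := (CC R).
Implicit Types (S : X -> X) (M N : set X).

Lemma blin_continuous (T : {linear X -> X}) : continuous T -> blin T.
Proof.
move=> cT; split; first exact: linearP.
have /linear_boundedP[B [Br BP]] := continuous_linear_bounded 0 (cT 0).
pose C := `|complex.Re (B : R[i])| + 1.
exists C; first by rewrite ltr_wpDl.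
have BC : (B : R[i]) < C%:C%C.
  by rewrite -(RRe_real Br) ltcR /C; have := ler_norm (complex.Re (B : R[i])); lra.
by move=> x; rewrite -lecR rmorphM /= !nmE; exact: BP.
Qed.

Lemma linear_shift S l : linear S -> linear (Defs.shift S l).
Proof.
move=> lS a x y.
by rewrite /Defs.shift lS scalerBr scalerDr !scalerA (mulrC a) opprD addrACA.
Qed.

Lemma blin_shift S l : blin S -> blin (Defs.shift S l).
Proof.
move=> [lS [C C0 SC]]; split; first exact: linear_shift.
exists (C + nm l); first by rewrite ltr_wpDr ?nm_ge0.
move=> x; have := nm_sub (S x) (l *: x); rewrite nmZ; have := SC x; rewrite /Defs.shift; lra.
Qed.

Lemma shift_shift S l z : Defs.shift (Defs.shift S l) z = Defs.shift S (l + z).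
Proof. by apply/funext => x; rewrite /Defs.shift scalerDl opprD addrA. Qed.

Lemma bounded_belowP S M : blin S -> lsub M -> closed M ->
  bounded_below_on S M <-> exists2 c : R, 0 < c & forall x, M x -> c * nm x <= nm (S x).
Proof.
move=> bS lM cM; have [lS _] := bS; split=> [[inj cS]|[c c0 low]].
  apply: lower_bound => //; [exact: closed_hcomplete|exact: closed_hcomplete|].
  move=> x Mx Sx; apply: inj; rewrite ?inE//; first exact: lsub0.
  by rewrite (lin0 lS).
split.
  move=> x y; rewrite !inE => Mx My Sxy; apply/eqP; rewrite -subr_eq0; apply/eqP/nm_eq0/le_anti.
  rewrite nm_ge0 andbT -(ler_pM2l c0) mulr0; apply: le_trans (low _ _) _; first exact: lsubB.
  by rewrite (linB lS) Sxy subrr nm0.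
apply: hcomplete_closed; apply: hcomplete_image low => //; exact: closed_hcomplete.
Qed.

Lemma lsub_setT : lsub [set: X]. Proof. by []. Qed.

(** Every vector of [M] killed by a power of [S] lies in the range: if [iter n.+1 S x = 0], the Kato
    condition writes [iter n S x] as [iter n.+1 S u], and [x - S u] is killed by a lower power.
    Preimage chains from [x0] therefore never stop. *)
Lemma Kato_kernel_eigenvectors S M (x0 : X) :
  blin S -> lsub M -> closed M -> Defs.invariant S M -> Kato_on S M ->
  M x0 -> S x0 = 0 -> x0 != 0 ->
  exists2 e : R, 0 < e & forall z : K, nm z < e -> exists2 x, x != 0 & S x = z *: x.
Proof.
move=> bS lM cM SM [cS kerS] Mx0 Sx0 x0n; have [lS _] := bS.
have lit n : linear (iter n S) by elim: n => [|n IH] a x y //=; rewrite IH lS.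
have Mit n x : M x -> M (iter n S x) by move=> Mx; elim: n => //= n; exact: SM.
have kerR n x : M x -> iter n S x = 0 -> (S @` M) x.
  elim: n x => [|n IH] x Mx; first by move=> /= ->; exists 0; [exact: lsub0|exact: lin0].
  move=> Snx; have [|u Mu] := kerS n.+1 (iter n S x); first by split; [exact: Mit|].
  rewrite iterSr => Su; have [||v Mv Sv] := IH (x - S u).
  - by apply: lsubB => //; exact: SM.
  - by rewrite (linB (lit n)) Su subrr.
  by exists (u + v); [exact: lsubD|rewrite (linD lS) Sv subrKC].
have [C C0 CP] := open_mapping lM (closed_hcomplete cM) bS (closed_hcomplete cS).
exists (C^-1 / 4); first by rewrite divr_gt0 ?invr_gt0.
move=> z zC.
apply: (@eigenvectors_near R X S [set x | M x /\ exists n, iter n S x = 0] C x0) => //.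
- move=> x [Mx [n nx]]; have [y My [yx ny]] := CP x (kerR n x Mx nx).
  by exists y => //; split => //; exists n.+1; rewrite iterSr yx.
- by split => //; exists 1%N.
- by rewrite -ler_pdivlMr//; lra.
Qed.

(** Addition is a bounded bijection from the product of [M] and [N] onto [X], hence bounded
    below. *)
Lemma reducing_pair_norm S M N : reducing_pair S M N ->
  exists2 c : R, 0 < c & forall x y, M x -> N y -> c * nm x <= nm (x + y) /\ c * nm y <= nm (x + y).
Proof.
move=> [lM [lN [cM [cN [_ [_ [MN0 MNX]]]]]]].
pose f (p : X * X) : X := p.1 + p.2.
have lf : linear f by move=> a [x y] [u v]; rewrite /f /= scalerDr addrACA.
have fb p : nm (f p) <= 2 * nm p.
  have h1 : nm p.1 <= nm p by rewrite nm_pair le_max lexx.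
  have h2 : nm p.2 <= nm p by rewrite nm_pair le_max lexx orbT.
  by have := nm_triangle p.1 p.2; rewrite /f; lra.
have [||||p|c c0 low] := @lower_bound R _ _ f (M `*` N).
- split; first by split; [case: lM|case: lN].
  by move=> a x y [Mx Nx] [My Ny]; split; [case: lM => _|case: lN => _]; apply.
- by apply: hcomplete_setX; exact: closed_hcomplete.
- by split => //; exists 2 => //; lra.
- suff -> : f @` (M `*` N) = setT by apply: closed_hcomplete; exact: closedT.
  by apply/seteqP; split => // x _; have [m [n [Mm [Nn ->]]]] := MNX x; exists (m, n).
- case: p => x y [/= Mx Ny]; rewrite /f /= => xy0.
  have yx : y = - x by apply/eqP; rewrite -addr_eq0 addrC xy0.
  have : (M `&` N) x.
    by split => //; rewrite -[x]opprK -yx; exact: lsubN.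
  by rewrite MN0 /= => x0; rewrite yx x0 oppr0.
exists c => // x y Mx Ny; have := low (x, y) (conj Mx Ny); rewrite nm_pair /f /=.
move=> h; split; apply: le_trans h; rewrite ler_pM2l// le_max lexx ?orbT//.
Qed.

Lemma reducing_pair_bounded_below S f M N (a b : R) : reducing_pair S M N -> linear f ->
  Defs.invariant f M -> Defs.invariant f N -> 0 < a -> 0 < b ->
  (forall x, M x -> a * nm x <= nm (f x)) -> (forall x, N x -> b * nm x <= nm (f x)) ->
  exists2 c : R, 0 < c & forall x, c * nm x <= nm (f x).
Proof.
move=> MN lf fM fN a0 b0 fa fb; have [c c0 cP] := reducing_pair_norm MN.
have [_ [_ [_ [_ [_ [_ [_ MNX]]]]]]] := MN.
pose d := (a^-1 + b^-1) / c.
have d0 : 0 < d by rewrite divr_gt0 ?addr_gt0 ?invr_gt0.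
exists d^-1; first by rewrite invr_gt0.
move=> x; have [m [n [Mm [Nn ->]]]] := MNX x; rewrite (linD lf) ler_pdivrMl//.
have [h1 h2] := cP _ _ (fM _ Mm) (fN _ Nn).
have g1 : nm m <= a^-1 * (nm (f m + f n) / c).
  by rewrite ler_pdivlMl// ler_pdivlMr// mulrC; apply: le_trans h1; rewrite ler_pM2l// fa.
have g2 : nm n <= b^-1 * (nm (f m + f n) / c).
  by rewrite ler_pdivlMl// ler_pdivlMr// mulrC; apply: le_trans h2; rewrite ler_pM2l// fb.
have := nm_triangle m n; rewrite /d; lra.
Qed.

Lemma sigma_ap_sub_spectrum S : sigma_ap S `<=` spectrum S.
Proof.
move=> l nbb [g [_ [_ [gS Sg]]]]; apply: nbb; split.
  by move=> x y _ _ xy; rewrite -(gS x I) xy gS.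
suff -> : Defs.shift S l @` setT = setT by exact: closedT.
by apply/seteqP; split => // y _; exists (g y) => //; exact: Sg.
Qed.

Lemma eigenvector_sigma_ap S l (x : X) : blin S -> x != 0 -> Defs.shift S l x = 0 -> sigma_ap S l.
Proof.
move=> bS x0 Sx [inj _]; move/eqP: x0; apply; apply: inj; rewrite ?inE//.
by have [lS _] := blin_shift l bS; rewrite Sx (lin0 lS).
Qed.

End Operators.

(** * From the various decompositions to a GKRD, and its impossibility on [sigma_ap] *)

Section Decompositions.
Context {R : realType} {X : completeNormedModType (CC R)}.
Local Notation K := (CC R).
Implicit Types (S : X -> X) (M N : set X).

Lemma bijective_Fredholm S N : lsub N -> closed N ->
  (forall x, N x -> N (S x)) -> (forall x, N x -> S x = 0 -> x = 0) ->
  (forall y, N y -> exists2 x, N x & S x = y) -> Fredholm_on S N.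
Proof.
move=> lN cN SN inj surj; split; last split.
- exists [::]; split => // x [Nx Sx]; exists (fun=> 0).
  by rewrite big_ord0; exact: inj.
- suff -> : S @` N = N by [].
  apply/seteqP; split=> [_ [x Nx <-]|y Ny]; first exact: SN.
  by have [x Nx xy] := surj y Ny; exists x.
- exists [::]; split => // y Ny; have [x Nx xy] := surj y Ny.
  by exists x, (fun=> 0); rewrite big_ord0 addr0.
Qed.

Lemma shift_invariant S N z : lsub N -> Defs.invariant S N ->
  Defs.invariant (Defs.shift S z) N.
Proof. by move=> lN SN x Nx; apply: lsubB => //; [exact: SN|exact: lsubZ]. Qed.

Lemma quasinilpotent_Riesz S N : linear S -> lsub N -> closed N -> Defs.invariant S N ->
  quasinilpotent_on S N -> Riesz_on S N.
Proof.
move=> lS lN cN SN qS z z0; have [g [gN [_ [gS Sg]]]] := qS z z0.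
apply: bijective_Fredholm => //.
- exact: shift_invariant.
- move=> x Nx Sx; rewrite -(gS x Nx) Sx -[RHS](gS 0 (lsub0 lN)).
  by rewrite (lin0 (linear_shift z lS)).
- by move=> y Ny; exists (g y); [exact: gN|exact: Sg].
Qed.

(** An eigenvector for [z] satisfies [iter n S x = z ^+ n *: x], so it vanishes; surjectivity of
    [S - z] goes by induction on the power that kills the target. *)
Lemma nilpotent_Riesz S N : linear S -> lsub N -> closed N -> Defs.invariant S N ->
  nilpotent_on S N -> Riesz_on S N.
Proof.
move=> lS lN cN SN [n nS] z z0; apply: bijective_Fredholm => //.
- exact: shift_invariant.
- move=> x Nx /eqP; rewrite subr_eq0 => /eqP Sx.
  have itz k : iter k S x = z ^+ k *: x.
    elim: k => [|k IH]; first by rewrite expr0 scale1r.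
    by rewrite iterS IH (linZ lS) Sx scalerA -exprSr.
  have /eqP := nS x Nx; rewrite itz scaler_eq0 expf_eq0 (negbTE z0) andbF.
  by move/eqP.
- move=> y Ny.
  suff main k : forall y, N y -> iter k S y = 0 -> exists2 x, N x & Defs.shift S z x = y.
    by apply: (main n) => //; exact: nS.
  elim: k => [|k IHk] {Ny} u Nu /=.
    by move=> ->; exists 0; [exact: lsub0|rewrite (lin0 (linear_shift z lS))].
  rewrite -iterS iterSr => /(IHk _ (SN u Nu))[x Nx xSu].
  (* From [(S - z) x = S u] follows [(S - z) (x - u) = z *: u]. *)
  exists (z^-1 *: (x - u)); first by apply: lsubZ => //; exact: lsubB.
  have lSz := linear_shift z lS; rewrite (linZ lSz) (linB lSz) xSu /Defs.shift.
  by rewrite opprB subrKC scalerA mulVf// scale1r.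
Qed.

Lemma fredholm_lspan S N : linear S -> lsub N -> Fredholm_on S N ->
  closed (S @` N) /\ exists s, [set x | N x /\ S x = 0] = lspan s.
Proof.
move=> lS lN [fk [cSN _]]; split => //; apply: fin_dim_lspan => //.
split; first by split; [exact: lsub0|exact: lin0].
move=> a x y [Nx Sx] [Ny Sy]; split; first by case: lN => _; apply.
by rewrite lS Sx Sy scaler0 addr0.
Qed.

Lemma trivial_reducing_pair S : linear S -> reducing_pair S setT [set 0].
Proof.
move=> lS; split; first exact: lsub_setT.
split; first by split => // a x y -> ->; rewrite scaler0 addr0.
split; first exact: closedT.
split; first by apply/accessible_closed_set1/hausdorff_accessible/norm_hausdorff.
split=> //; split; first by move=> x ->; exact: lin0.
by split; [rewrite setTI|move=> x; exists x, 0; rewrite addr0].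
Qed.

Lemma bounded_below_Kato S M : linear S -> bounded_below_on S M -> lsub M -> Kato_on S M.
Proof.
move=> lS [inj cS] lM; split => // n x [Mx Sx].
have -> : x = 0.
  by apply: inj; rewrite ?inE//; [exact: lsub0|rewrite Sx (lin0 lS)].
exists 0; first exact: lsub0.
by elim: n => //= n ->; exact: lin0.
Qed.

Lemma sigma_ap_no_disc S (l : K) (e : R) : sigma_ap S = cboundary (Defs.spectrum S) ->
  0 < e -> ~ (forall m, nm (m - l) < e -> sigma_ap S m).
Proof.
move=> apE e0 H; have : sigma_ap S l by apply: H; rewrite subrr nm0.
rewrite apE => -[_]; apply; apply/nbhs_ballP; exists e%:C%C; first by rewrite /= ltcR.
move=> m; rewrite -ball_normE /= nm_lt nmB => /H; exact: sigma_ap_sub_spectrum.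
Qed.

Lemma sigma_ap_accumulation S (l : K) (e : R) : sigma_ap S = cboundary (Defs.spectrum S) ->
  (forall l, cboundary (Defs.spectrum S) l -> ~ isolated_in (Defs.spectrum S) l) ->
  sigma_ap S l -> 0 < e -> exists z, [/\ z != 0, nm z < e & sigma_ap S (l + z)].
Proof.
move=> apE nis apl e0; apply: contrapT => H.
have bl : cboundary (Defs.spectrum S) l by rewrite -apE.
apply: (nis l bl); apply: (isolated_boundary e0) => //; first exact: sigma_ap_sub_spectrum.
move=> m ml me; rewrite -apE => apm; apply: H; exists (m - l).
by rewrite subr_eq0 subrKC.
Qed.

Lemma sigma_ap_no_GKRD S (l : K) : blin S -> sigma_ap S = cboundary (Defs.spectrum S) ->
  (forall l, cboundary (Defs.spectrum S) l -> ~ isolated_in (Defs.spectrum S) l) ->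
  sigma_ap S l -> ~ has_GKRD (Defs.shift S l).
Proof.
move=> bS apE nis apl [M [N [MN [kM rN]]]].
have no_eigenvectors (m : K) (e : R) : 0 < e ->
    ~ (forall z : K, nm z < e -> exists2 x, x != 0 & Defs.shift S m x = z *: x).
  move=> e0 H; apply: (@sigma_ap_no_disc S m e) => // m' /H[x x0 mx].
  apply: (eigenvector_sigma_ap bS x0).
  by rewrite -(subrKC m m') -shift_shift {1}/Defs.shift mx subrr.
have [lM [lN [cM [cN [SM [SN _]]]]]] := MN.
have bSl := blin_shift l bS; have [lSl _] := bSl.
have [c c0 low] : exists2 c : R, 0 < c & forall x, M x -> c * nm x <= nm (Defs.shift S l x).
  apply: lower_bound => //; [exact: closed_hcomplete|apply: closed_hcomplete; by case: kM|].
  move=> x Mx Sx; apply: contrapT => /eqP x0.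
  have [e e0 eP] := Kato_kernel_eigenvectors bSl lM cM SM kM Mx Sx x0.
  exact: no_eigenvectors e0 eP.
have lowM z x : M x -> (c - nm z) * nm x <= nm (Defs.shift S (l + z) x).
  move=> /low h; have := nm_split (z *: x) (Defs.shift S l x) 0.
  rewrite !subr0 nmZ -shift_shift {3}/Defs.shift; lra.
have [w [w0 wc apw]] := sigma_ap_accumulation apE nis apl c0.
have [cSN [s kerE]] := fredholm_lspan (proj1 (blin_shift w bSl)) lN (rN w w0).
have [[e e0 eP]|[e e0 eP]] := semi_fredholm_dichotomy (blin_shift w bSl) lN cN
  (shift_invariant w lN SN) cSN kerE.
  by apply: (no_eigenvectors (l + w) e e0); rewrite -shift_shift; exact: eP.
(* Below [e] the part on [N] is bounded below; below [c - nm w] the total shift [w + z] stays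
   smaller than [c], so the part on [M] is too. *)
pose d := Num.min e (c - nm w).
have d0 : 0 < d by rewrite lt_min e0 subr_gt0.
(* As [l + w + z] is in [sigma_ap S], it remains to show the contradictory lower bound there. *)
have [z [z0 zd []]] := sigma_ap_accumulation apE nis apw d0.
move: zd; rewrite lt_min => /andP[ze zw].
have [b b0 bP] := eP z z0 ze.
have bSz := blin_shift (l + w + z) bS.
apply/(bounded_belowP bSz lsub_setT closedT).
have sE : Defs.shift S (l + w + z) = Defs.shift (Defs.shift (Defs.shift S l) w) z.
  by rewrite !shift_shift addrA.
have iM : Defs.invariant (Defs.shift S (l + w + z)) M.
  by rewrite sE; exact: (shift_invariant z lM (shift_invariant w lM SM)).
have iN : Defs.invariant (Defs.shift S (l + w + z)) N.
  by rewrite sE; exact: (shift_invariant z lN (shift_invariant w lN SN)).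
have a0 : 0 < c - nm (w + z) by have := nm_triangle w z; lra.
have [||c' c'0 c'P] := reducing_pair_bounded_below MN (proj1 bSz) iM iN a0 b0.
- by move=> x Mx; rewrite -addrA; exact: lowM.
- by move=> x Nx; rewrite sE; exact: bP.
by exists c' => // x _; exact: c'P.
Qed.
End Decompositions.

(** * Equality of the spectra *)

(** A sandwich: a property implied by being bounded below and implying a GKRD fails exactly on
    [sigma_ap S]. Each spectrum of the theorem is an instance. *)
Lemma has_property_sigma_ap (R : realType) (X : completeNormedModType (CC R)) (S : X -> X)
  (P : (X -> X) -> Prop) :
  blin S -> sigma_ap S = cboundary (Defs.spectrum S) ->
  (forall l, cboundary (Defs.spectrum S) l -> ~ isolated_in (Defs.spectrum S) l) ->
  (forall f, linear f -> bounded_below_on f setT -> P f) ->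
  (forall f, linear f -> P f -> has_GKRD f) ->
  [set l | ~ P (Defs.shift S l)] = sigma_ap S.
Proof.
move=> bS apE nis bbP PGKRD; have [lS _] := bS.
apply/seteqP; split=> l /=; first by move=> nP bb; apply: nP; apply: bbP => //; exact: linear_shift.
move=> apl PS; apply: (sigma_ap_no_GKRD bS apE nis apl).
by apply: PGKRD => //; exact: linear_shift.
Qed.

Theorem theorem3p22 (R : realType) (X : completeNormedModType (CC R))
  (T : {linear X -> X}) :
  ~ fin_dim (@setT X) ->
  continuous T ->
  sigma_ap T = cboundary (spectrum T) ->
  (forall l, cboundary (spectrum T) l -> ~ isolated_in (spectrum T) l) ->
  sigma_ec T `<=` sigma_ap T /\
  sigma_ap T = sigma_gKR T /\
  sigma_gKR T = sigma_gK T /\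
  sigma_gK T = sigma_Kt T /\
  sigma_Kt T = sigma_eK T /\
  sigma_eK T = sigma_K T /\
  sigma_K T = sigma_gDRM T.
Proof.
move=> _ /blin_continuous bT apE nis.
have sig := has_property_sigma_ap bT apE nis.
have KatoT (f : X -> X) : linear f -> bounded_below_on f setT -> Kato_on f setT.
  by move=> lf bbf; apply: bounded_below_Kato => //; exact: lsub_setT.
have nil0 f : nilpotent_on f [set (0 : X)] by exists 0%N => x ->.
have Riesz0 f : linear f -> Riesz_on f [set (0 : X)].
  move=> lf; have [_ [l0 [_ [c0 [_ [i0 _]]]]]] := trivial_reducing_pair lf.
  exact: nilpotent_Riesz.
have nilRiesz (f : X -> X) M N : linear f -> reducing_pair f M N -> nilpotent_on f N -> Riesz_on f N.
  by move=> lf [_ [lN [_ [cN [_ [SN _]]]]]]; exact: nilpotent_Riesz.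
have triv f := @trivial_reducing_pair R X f.
have quasi0 f : linear f -> quasinilpotent_on f [set (0 : X)].
  move=> lf z _; have s0 := lin0 (linear_shift z lf).
  exists (fun=> 0); do !split => //; try by move=> x ->.
  exact/continuous_subspaceT/cst_continuous.
have gKR : sigma_gKR T = sigma_ap T.
  (* A bounded below operator is decomposed with the zero space as second summand, on which every
     required condition is trivial. *)
  by apply: sig => // f lf bbf; exists setT, [set 0]; split; [exact: triv|split; auto].
have gK : sigma_gK T = sigma_ap T.
  apply: sig => f lf; first by move=> bbf; exists setT, [set 0]; split; [exact: triv|split; auto].
  move=> [M [N [MN [kM qN]]]]; exists M, N; split => //; split => //.
  by have [_ [lN [_ [cN [_ [SN _]]]]]] := MN; exact: quasinilpotent_Riesz.
have Kt : sigma_Kt T = sigma_ap T.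
  apply: sig => f lf; first by move=> bbf; exists setT, [set 0]; split; [exact: triv|split; auto].
  by move=> [M [N [MN [kM qN]]]]; exists M, N; split => //; split => //; exact: nilRiesz MN qN.
have eK : sigma_eK T = sigma_ap T.
  apply: sig => f lf; last first.
    by move=> [M [N [MN [kM [_ qN]]]]]; exists M, N; split => //; split => //; exact: nilRiesz MN qN.
  move=> bbf; exists setT, [set 0]; split; [exact: triv|split; [exact: KatoT|split => //]].
  by exists [::]; split => // x ->; exists (fun=> 0); rewrite big_ord0.
have K : sigma_K T = sigma_ap T.
  by apply: sig => f lf kf; [exact: KatoT|exists setT, [set 0]; split; [exact: triv|split; auto]].
have gDRM : sigma_gDRM T = sigma_ap T.
  apply: sig => f lf; first by move=> bbf; exists setT, [set 0]; split; [exact: triv|split; auto].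
  move=> [M [N [MN [bM rN]]]]; exists M, N; split => //; split => //.
  by apply: bounded_below_Kato => //; case: MN.
(* A range that is not closed contradicts the second half of [bounded_below_on]. *)
rewrite gKR gK Kt eK K gDRM; split => // l nc [_ /nc]//.
Qed.
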